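(* Let $t,x,y$ be real numbers with $t>0$, $y+1>0$ and $x+y+1>0$, and let $a,b$ be real numbers. The double inequality $$ \biggl(\frac{x+y+1}{x+y+t+1}\biggr)^a <\frac{[\Gamma(x+y+1)/\Gamma(y+1)]^{1/x}}{[\Gamma(x+y+t+1)/\Gamma(y+1)]^{1/(x+t)}} <\biggl(\frac{x+y+1}{x+y+t+1}\biggr)^b $$ holds if $a\ge\max\bigl\{1,\frac1{y+1}\bigr\}$ and $b\le\min\bigl\{1,\frac1{2(y+1)}\bigr\}$.
   Context: $\Gamma$ is the classical Euler gamma function and $\psi(x)=\Gamma'(x)/\Gamma(x)$ is the digamma function, for $x>0$. Convention for the removable singularity: the expression $[\Gamma(s+y+1)/\Gamma(y+1)]^{1/s}$ is understood as $\exp[\psi(y+1)]$ when $s=0$ (this applies to the numerator when $x=0$ and to the denominator when $x+t=0$). *)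

(* Defs.v *)
From Stdlib Require Export Reals.
From Coquelicot Require Export Coquelicot.
Open Scope R_scope.

(* Euler's integral over (0, +oo), improper at both ends; it converges, and so
   has its classical meaning, exactly for x > 0. *)
Definition Gamma (x : R) : R :=
  RInt_gen (fun u => Rpower u (x - 1) * exp (- u))
           (at_right 0) (Rbar_locally p_infty).

Definition digamma (x : R) : R := Derive Gamma x / Gamma x.

(* [Gamma(s+y+1)/Gamma(y+1)]^(1/s), with its removable singularity at s = 0
   filled in; meaningful for y + 1 > 0 and s + y + 1 > 0, where the base of the
   power is positive. *)
Definition gamma_ratio_root (y s : R) : R :=
  if Req_EM_T s 0 then exp (digamma (y + 1))
  else Rpower (Gamma (s + y + 1) / Gamma (y + 1)) (1 / s).

(* Main.v *)
Require Import Defs.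
From Stdlib Require Import Reals Lra.
From Coquelicot Require Import Coquelicot.
Open Scope R_scope.

(** Put c = y + 1 and L = ln Gamma. Then ln (gamma_ratio_root y x) is the slope
    (L(z) - L(c)) / (z - c) of L between c and z = x + c, completed at z = c by
    L'(c) = digamma c. After taking logarithms the two inequalities say that, as z
    increases over (0, +oo), a ln z minus this slope and this slope minus b ln z
    both increase strictly. Now ln z is itself the slope from c of (z - c) ln z, so
    these two functions are slopes from c of
      a (z - c) ln z - L(z)   and   L(z) - b (z - c) ln z,
    and slopes of a strictly convex function from a fixed point increase strictly.
    It remains to see that both functions are strictly convex. With
      N(z) = (z - 1) ln z - L(z)   and   M(z) = L(z) - (z - 1/2) ln z
    they are respectively
      N(z) + (a - 1) z ln z + (a c - 1) (- ln z),
      M(z) + (1 - b) z ln z + (1/2 - b c) (- ln z),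
    and the hypotheses on a and b say exactly that the coefficients of the convex
    functions z ln z and - ln z are nonnegative. So everything rests on the strict
    convexity of M and N ([lnGamma_sub_strictly_convex],
    [sub_lnGamma_strictly_convex]).

    For f = M or N the difference f(z) - f(z + 1) is elementary, because
    L(z + 1) - L(z) = ln z, and it is strictly convex by its second derivative.
    Summing over the translates by 0, 1, ..., n - 1 gives the convexity of f up to
    its failure far to the right, and that failure tends to 0: L is convex by
    Hoelder's inequality, and its slopes far out are squeezed between slopes over
    unit intervals, that is, between logarithms.

    The derivative of Gamma, which enters through digamma, is obtained without
    differentiating under the integral sign: M and N are convex and their sum
    - (1/2) ln z is differentiable, which forces each to be differentiable
    ([ex_derive_of_convex_sum]). *)

(** * Improper integrals over the positive half-line *)

Notation is_RInt_pos f l :=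
  (is_RInt_gen f (at_right 0) (Rbar_locally p_infty) l).

Lemma near_zero_infty (d M : R) (P : R * R -> Prop) :
  0 < d ->
  (forall a b, 0 < a < d -> M < b -> a < b -> P (a, b)) ->
  filter_prod (at_right 0) (Rbar_locally p_infty) P.
Proof.
  intros Hd HP.
  apply (Filter_prod _ _ _ (fun a => 0 < a < d) (fun b => Rmax M d < b)).
  - exists (mkposreal d Hd). intros a Ha Ha0. split; [exact Ha0|].
    unfold ball in Ha; simpl in Ha; unfold AbsRing_ball, abs, minus, plus, opp in Ha;
    simpl in Ha. apply Rabs_def2 in Ha. lra.
  - exists (Rmax M d). intros b Hb. exact Hb.
  - intros a b Ha Hb. pose proof (Rmax_l M d). pose proof (Rmax_r M d).
    apply HP; lra.
Qed.

Lemma is_RInt_pos_of_FTC (F f : R -> R) (l0 l1 : R) :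
  (forall u, 0 < u -> is_derive F u (f u)) ->
  (forall u, 0 < u -> continuous f u) ->
  (forall e, 0 < e -> exists d, 0 < d /\ forall u, 0 < u < d -> Rabs (F u - l0) < e) ->
  (forall e, 0 < e -> exists M, forall u, M < u -> Rabs (F u - l1) < e) ->
  is_RInt_pos f (l1 - l0).
Proof.
  intros HF Hf H0 H1 P [e He].
  destruct (H0 (e / 2)) as [d [Hd Hd']]; [apply is_pos_div_2|].
  destruct (H1 (e / 2)) as [M HM]; [apply is_pos_div_2|].
  apply (near_zero_infty d M); [exact Hd|].
  intros a b Ha Hb Hab. simpl. exists (minus (F b) (F a)). split.
  - apply (is_RInt_derive F f);
      rewrite Rmin_left, Rmax_right by lra; intros u Hu;
      [apply HF | apply Hf]; lra.
  - apply He. unfold ball; simpl; unfold AbsRing_ball, abs, minus, plus, opp; simpl.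
    specialize (Hd' a Ha). specialize (HM b Hb).
    apply Rabs_def2 in Hd', HM. apply Rabs_def1; lra.
Qed.

(** The integrals over compact intervals increase with the interval, so they
    converge to their supremum. *)
Lemma is_RInt_pos_of_bounded (f : R -> R) (B : R) :
  (forall u, 0 < u -> 0 < f u) ->
  (forall u, 0 < u -> continuous f u) ->
  (forall a b, 0 < a < b -> RInt f a b <= B) ->
  exists l, is_RInt_pos f l /\ forall a b, 0 < a < b -> RInt f a b <= l.
Proof.
  intros Hpos Hc HB.
  assert (Hex : forall a b, 0 < a -> a <= b -> ex_RInt f a b).
  { intros a b Ha Hab. apply (ex_RInt_continuous f a b).
    rewrite Rmin_left by lra. intros u Hu. apply Hc; lra. }
  assert (Hge : forall a b, 0 < a -> a <= b -> 0 <= RInt f a b).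
  { intros a b Ha Hab. apply RInt_ge_0; auto.
    intros u Hu. left; apply Hpos; lra. }
  destruct (completeness (fun s => exists a b, 0 < a < b /\ s = RInt f a b))
    as [l [Hub Hlub]].
  - exists B. intros s (a & b & Hab & ->). now apply HB.
  - exists (RInt f 1 2), 1, 2. split; [lra|reflexivity].
  - assert (Hl : forall a b, 0 < a < b -> RInt f a b <= l).
    { intros a b Hab. apply Hub. now exists a, b. }
    exists l. split; [|exact Hl].
    intros P [e He].
    assert (Hnear : exists a0 b0, 0 < a0 < b0 /\ l - e < RInt f a0 b0).
    { apply Classical_Prop.NNPP. intros Hn.
      apply (Rlt_not_le l (l - e)); [destruct e; simpl; lra|].
      apply Hlub. intros s (a & b & Hab & ->).
      apply Rnot_lt_le. intros Hlt. apply Hn. now exists a, b. }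
    destruct Hnear as (a0 & b0 & Hab0 & Hnear).
    apply (near_zero_infty a0 b0); [lra|].
    intros a b Ha Hb Hab. simpl. exists (RInt f a b). split.
    + apply (RInt_correct f). apply Hex; lra.
    + apply He. unfold ball; simpl; unfold AbsRing_ball, abs, minus, plus, opp; simpl.
      assert (E1 := RInt_Chasles f a a0 b (Hex a a0 ltac:(lra) ltac:(lra))
                      (Hex a0 b ltac:(lra) ltac:(lra))).
      assert (E2 := RInt_Chasles f a0 b0 b (Hex a0 b0 ltac:(lra) ltac:(lra))
                      (Hex b0 b ltac:(lra) ltac:(lra))).
      unfold plus in E1, E2; simpl in E1, E2.
      assert (G1 := Hge a a0 ltac:(lra) ltac:(lra)).
      assert (G2 := Hge b0 b ltac:(lra) ltac:(lra)).
      assert (G3 := Hl a b ltac:(lra)).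
      destruct e as [e Hepos]; simpl in *. apply Rabs_def1; lra.
Qed.

Lemma is_RInt_pos_le (f g : R -> R) (lf lg : R) :
  (forall u, 0 < u -> 0 <= f u <= g u) ->
  is_RInt_pos f lf -> is_RInt_pos g lg -> lf <= lg.
Proof.
  intros H Hf Hg. apply Rle_trans with (norm lf); [apply Rle_abs|].
  apply (RInt_gen_norm (Fa := at_right 0) (Fb := Rbar_locally p_infty) f g);
    [| |exact Hf|exact Hg];
    apply (near_zero_infty 1 1); try lra; simpl; intros a b Ha Hb Hab; [lra|].
  intros u Hu. destruct (H u ltac:(lra)) as [H1 H2].
  unfold norm; simpl; unfold abs; simpl. rewrite Rabs_pos_eq; lra.
Qed.

Lemma is_RInt_pos_lin (f g : R -> R) (p q lf lg : R) :
  is_RInt_pos f lf -> is_RInt_pos g lg ->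
  is_RInt_pos (fun u => p * f u + q * g u) (p * lf + q * lg).
Proof.
  intros Hf Hg.
  exact (is_RInt_gen_plus (V := R_NormedModule) _ _ _ _
           (is_RInt_gen_scal (V := R_NormedModule) f p lf Hf)
           (is_RInt_gen_scal (V := R_NormedModule) g q lg Hg)).
Qed.

(** * Elementary properties of the gamma function *)
Notation euler z := (fun u => Rpower u (z - 1) * exp (- u)).

Lemma euler_pos z u : 0 < Rpower u (z - 1) * exp (- u).
Proof. apply Rmult_lt_0_compat; apply exp_pos. Qed.

Lemma continuous_euler z u : 0 < u -> continuous (euler z) u.
Proof.
  intros Hu. apply (ex_derive_continuous (V := R_NormedModule)).
  unfold Rpower. auto_derive. exact Hu.
Qed.

Lemma exp_le_compat p q : p <= q -> exp p <= exp q.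
Proof.
  intros [H | ->]; [left; now apply exp_increasing | apply Rle_refl].
Qed.

Lemma ln_le_sub_1 r : 0 < r -> ln r <= r - 1.
Proof.
  intros Hr. assert (H := exp_ineq1_le (ln r)). rewrite exp_ln in H by exact Hr. lra.
Qed.

(** This is ln r <= r - 1 at r = (1 + u) / (z + 1), the point of tangency being
    the maximum of (1 + u)^(z+1) exp (- u); the bound serves both the convergence
    of Euler's integral and the vanishing of boundary terms. *)
Lemma exp_decay z u : 0 < z -> 0 < u ->
  exp (- u) <= Rpower (z + 1) (z + 1) * Rpower (1 + u) (- (z + 1)).
Proof.
  intros Hz Hu. unfold Rpower. rewrite <- exp_plus.
  assert (H := ln_le_sub_1 ((1 + u) / (z + 1)) ltac:(apply Rdiv_lt_0_compat; lra)).
  rewrite ln_div in H by lra.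
  apply (Rmult_le_compat_l (z + 1)) in H; [|lra].
  replace ((z + 1) * ((1 + u) / (z + 1) - 1)) with (u - z) in H by (field; lra).
  apply exp_le_compat. lra.
Qed.

(** By [exp_decay] the integrand is dominated by C u^(z-1) / (1 + u)^(z+1), whose
    primitive (C / z) (u / (1 + u))^z stays between 0 and C / z. This single
    majorant takes care of both ends at once. *)
Lemma ex_euler_integral z : 0 < z ->
  exists l, is_RInt_pos (euler z) l /\
    forall a b, 0 < a < b -> RInt (euler z) a b <= l.
Proof.
  intros Hz. set (C := Rpower (z + 1) (z + 1)).
  set (F := fun u => C / z * exp (z * (ln u - ln (1 + u)))).
  set (g := fun u => C * (Rpower u (z - 1) * Rpower (1 + u) (- (z + 1)))).
  assert (HC : 0 < C) by apply exp_pos.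
  assert (HFg : forall u, 0 < u -> is_derive F u (g u)).
  { intros u Hu. unfold F, g, Rpower. auto_derive; [repeat split; lra|].
    rewrite <- exp_plus.
    replace ((z - 1) * ln u + - (z + 1) * ln (1 + u))
      with (z * (ln u - ln (1 + u)) + - (ln u + ln (1 + u))) by ring.
    rewrite exp_plus, exp_Ropp, exp_plus, !exp_ln by lra. unfold Rminus. field. lra. }
  assert (Hg : forall u, 0 < u -> continuous g u).
  { intros u Hu. apply (ex_derive_continuous (V := R_NormedModule)).
    unfold g, Rpower. auto_derive. repeat split; lra. }
  apply (is_RInt_pos_of_bounded (euler z) (C / z)).
  - intros u _. apply euler_pos.
  - apply continuous_euler.
  - intros a b Hab.
    assert (HI : is_RInt g a b (minus (F b) (F a))).
    { apply (is_RInt_derive F g); rewrite Rmin_left, Rmax_right by lra;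
        intros u Hu; [apply HFg | apply Hg]; lra. }
    apply Rle_trans with (RInt g a b).
    + apply RInt_le; [lra| |now exists (minus (F b) (F a))|].
      * apply (ex_RInt_continuous (euler z)). rewrite Rmin_left by lra.
        intros u Hu. apply continuous_euler; lra.
      * intros u Hu. unfold g.
        assert (H := exp_decay z u Hz ltac:(lra)). fold C in H.
        apply (Rmult_le_compat_l (Rpower u (z - 1))) in H;
          [lra | left; apply exp_pos].
    + rewrite (is_RInt_unique _ _ _ _ HI). unfold minus, plus, opp; simpl.
      assert (HCz : 0 < C / z) by now apply Rdiv_lt_0_compat.
      assert (0 < F a) by (apply Rmult_lt_0_compat; [exact HCz | apply exp_pos]).
      assert (F b <= C / z * 1); [|lra].
      apply Rmult_le_compat_l; [lra|].
      eapply Rle_trans; [apply exp_le_compat|right; apply exp_0].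
      assert (ln b < ln (1 + b)) by (apply ln_increasing; lra).
      nra.
Qed.

Lemma is_RInt_Gamma z : 0 < z -> is_RInt_pos (euler z) (Gamma z).
Proof.
  intros Hz. destruct (ex_euler_integral z Hz) as (l & Hl & _).
  unfold Gamma. now rewrite (is_RInt_gen_unique _ _ Hl).
Qed.

Lemma Gamma_pos z : 0 < z -> 0 < Gamma z.
Proof.
  intros Hz. destruct (ex_euler_integral z Hz) as (l & Hl & Hle).
  unfold Gamma. rewrite (is_RInt_gen_unique _ _ Hl).
  apply Rlt_le_trans with (RInt (euler z) 1 2); [|apply Hle; lra].
  apply RInt_gt_0; [lra| |].
  - intros u _. apply euler_pos.
  - intros u Hu. apply continuous_euler; lra.
Qed.

(** Integration by parts: z u^(z-1) exp (- u) - u^z exp (- u) is the derivative of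
    u^z exp (- u), which vanishes at 0 and at infinity. *)
Lemma Gamma_succ z : 0 < z -> Gamma (z + 1) = z * Gamma z.
Proof.
  intros Hz.
  set (F := fun u => Rpower u z * exp (- u)).
  set (f := fun u => z * (Rpower u (z - 1) * exp (- u))
                     - Rpower u (z + 1 - 1) * exp (- u)).
  assert (HF : is_RInt_pos f (0 - 0)).
  { apply (is_RInt_pos_of_FTC F).
    - intros u Hu. unfold F, f, Rpower. auto_derive; [exact Hu|].
      replace (z + 1 - 1) with z by ring.
      replace ((z - 1) * ln u) with (z * ln u + - ln u) by ring.
      rewrite exp_plus, (exp_Ropp (ln u)), exp_ln by lra. field. lra.
    - intros u Hu. apply (ex_derive_continuous (V := R_NormedModule)).
      unfold f, Rpower. auto_derive. repeat split; lra.
    - intros e He. (* u^z < e exactly when u < e^(1/z). *)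
 exists (exp (ln e / z)). split; [apply exp_pos|].
      intros u [Hu Hue]. rewrite Rminus_0_r. unfold F.
      rewrite Rabs_pos_eq by (left; apply Rmult_lt_0_compat; apply exp_pos).
      apply ln_increasing in Hue; [|exact Hu]. rewrite ln_exp in Hue.
      apply (Rmult_lt_compat_l z) in Hue; [|exact Hz].
      replace (z * (ln e / z)) with (ln e) in Hue by (field; lra).
      unfold Rpower. rewrite <- exp_plus.
      rewrite <- (exp_ln e) by exact He.
      apply exp_increasing. lra.
    - intros e He. set (C := Rpower (z + 1) (z + 1)).
      assert (HC : 0 < C) by apply exp_pos.
      (* By [exp_decay], u^z exp (- u) <= C / (1 + u). *)
      exists (C / e). intros u Hu.
      assert (0 < C / e) by now apply Rdiv_lt_0_compat.
      rewrite Rminus_0_r. unfold F.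
      rewrite Rabs_pos_eq by (left; apply Rmult_lt_0_compat; apply exp_pos).
      apply Rle_lt_trans with (C / (1 + u)).
      + assert (HD := exp_decay z u Hz ltac:(lra)). fold C in HD.
        apply (Rmult_le_compat_l (Rpower u z)) in HD; [|left; apply exp_pos].
        eapply Rle_trans; [exact HD|].
        replace (Rpower u z * (C * Rpower (1 + u) (- (z + 1))))
          with (C * (Rpower u z * Rpower (1 + u) (- (z + 1)))) by ring.
        apply Rmult_le_compat_l; [lra|].
        rewrite <- (exp_ln (1 + u)) at 2 by lra.
        unfold Rpower. rewrite <- exp_plus, <- exp_Ropp. apply exp_le_compat.
        assert (ln u < ln (1 + u)) by (apply ln_increasing; lra).
        assert (z * ln u <= z * ln (1 + u)) by (apply Rmult_le_compat_l; lra).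
        lra.
      + apply Rlt_div_l; [lra|]. apply Rlt_div_l in Hu; [|exact He].
        rewrite Rmult_comm in Hu. lra. }
  assert (HG := is_RInt_pos_lin _ _ z (-1) _ _ (is_RInt_Gamma z Hz)
                  (is_RInt_Gamma (z + 1) ltac:(lra))).
  assert (E : 0 - 0 = z * Gamma z + -1 * Gamma (z + 1)).
  { rewrite <- (is_RInt_gen_unique _ _ HF), <- (is_RInt_gen_unique _ _ HG).
    apply RInt_gen_ext_eq; [|now exists (0 - 0)].
    intros u. unfold f. simpl. ring. }
  lra.
Qed.

Notation lnGamma := (fun z => ln (Gamma z)).

Lemma lnGamma_succ z : 0 < z -> ln (Gamma (z + 1)) = ln (Gamma z) + ln z.
Proof.
  intros Hz. rewrite Gamma_succ by exact Hz.
  rewrite ln_mult by (try exact Hz; now apply Gamma_pos). ring.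
Qed.

(** * Convexity on the positive half-line *)

(** This is (v - u) times the height of the chord of f over [u, v] above f at w.
    The division-free form is linear in f and commutes with translations, which
    is what the telescoping argument needs. *)
Definition convexity_gap (f : R -> R) (u w v : R) :=
  (v - w) * f u + (w - u) * f v - (v - u) * f w.

Definition convex_pos (f : R -> R) :=
  forall u w v, 0 < u -> u < w -> w < v -> 0 <= convexity_gap f u w v.

Definition strictly_convex_pos (f : R -> R) :=
  forall u w v, 0 < u -> u < w -> w < v -> 0 < convexity_gap f u w v.

(** Average the tangent line inequalities at the point l p + (1 - l) q. *)
Lemma exp_convex l p q : 0 <= l <= 1 ->
  exp (l * p + (1 - l) * q) <= l * exp p + (1 - l) * exp q.
Proof.
  intros Hl. set (m := l * p + (1 - l) * q).
  assert (T : forall r, exp m * (1 + (r - m)) <= exp r).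
  { intros r. replace r with (m + (r - m)) at 2 by ring. rewrite exp_plus.
    apply Rmult_le_compat_l; [left; apply exp_pos | apply exp_ineq1_le]. }
  assert (Tp := Rmult_le_compat_l l _ _ ltac:(lra) (T p)).
  assert (Tq := Rmult_le_compat_l (1 - l) _ _ ltac:(lra) (T q)).
  assert (E : l * (exp m * (1 + (p - m))) + (1 - l) * (exp m * (1 + (q - m))) = exp m)
    by (unfold m; ring).
  lra.
Qed.

(** Hoelder's inequality. For w = l u + (1 - l) v the Euler integrands satisfy
    e_w = e_u^l e_v^(1-l); normalising e_u and e_v by their integrals and applying
    the weighted mean inequality pointwise gives
    e_w / (Gamma(u)^l Gamma(v)^(1-l)) <= l e_u / Gamma(u) + (1-l) e_v / Gamma(v),
    whose right-hand side has integral 1. *)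
Lemma lnGamma_convex : convex_pos lnGamma.
Proof.
  intros u w v Hu Huw Hwv. unfold convexity_gap.
  set (l := (v - w) / (v - u)).
  assert (Hl : 0 <= l <= 1).
  { split; [apply Rle_div_r | apply Rle_div_l]; lra. }
  assert (Hw : w = l * u + (1 - l) * v) by (unfold l; field; lra).
  assert (Pu := Gamma_pos u Hu). assert (Pv := Gamma_pos v ltac:(lra)).
  assert (Pw := Gamma_pos w ltac:(lra)).
  set (m := l * ln (Gamma u) + (1 - l) * ln (Gamma v)).
  assert (H : exp (- m) * Gamma w <= 1).
  { assert (Ir := is_RInt_pos_lin _ _ (l * / Gamma u) ((1 - l) * / Gamma v) _ _
                    (is_RInt_Gamma u Hu) (is_RInt_Gamma v ltac:(lra))).
    assert (Iw := is_RInt_Gamma w ltac:(lra)).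
    assert (Il := is_RInt_pos_lin _ _ (exp (- m)) 0 _ _ Iw Iw).
    replace (l * / Gamma u * Gamma u + (1 - l) * / Gamma v * Gamma v) with 1
      in Ir by (field; lra).
    rewrite Rmult_0_l, Rplus_0_r in Il.
    refine (is_RInt_pos_le _ _ _ _ _ Il Ir).
    intros s Hs. rewrite Rmult_0_l, Rplus_0_r. split.
    { left; apply Rmult_lt_0_compat; [apply exp_pos | apply euler_pos]. }
    rewrite <- (exp_ln (Gamma u)), <- (exp_ln (Gamma v)) by assumption.
    (* Write both sides with exponentials, so that [exp_convex] applies. *)
    rewrite !(Rmult_assoc l), !(Rmult_assoc (1 - l)), <- !exp_Ropp.
    unfold Rpower. rewrite <- !exp_plus.
    eapply Rle_trans; [|apply exp_convex; exact Hl].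
    right. f_equal. unfold m. rewrite Hw. ring. }
  rewrite <- (exp_ln (Gamma w)), <- exp_plus in H by exact Pw.
  rewrite <- exp_0 in H.
  assert (H' : - m + ln (Gamma w) <= 0).
  { apply Rnot_lt_le. intros Hlt. apply exp_increasing in Hlt. lra. }
  apply (Rmult_le_compat_l (v - u)) in H'; [|lra].
  unfold m in H'.
  replace ((v - u) * (- (l * ln (Gamma u) + (1 - l) * ln (Gamma v)) + ln (Gamma w)))
    with ((v - u) * ln (Gamma w) - (v - w) * ln (Gamma u) - (w - u) * ln (Gamma v))
    in H' by (unfold l; field; lra).
  lra.
Qed.

Lemma convexity_gap_mean_value (f df : R -> R) u w v :
  (forall z, 0 < z -> is_derive f z (df z)) ->
  0 < u -> u < w -> w < v ->
  exists p q, u < p < w /\ w < q < v /\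
    convexity_gap f u w v = (w - u) * (v - w) * (df q - df p).
Proof.
  intros Hf Hu Huw Hwv.
  destruct (MVT_cor2 f df u w Huw) as (p & Ep & Hp).
  { intros z Hz. apply is_derive_Reals, Hf. lra. }
  destruct (MVT_cor2 f df w v Hwv) as (q & Eq & Hq).
  { intros z Hz. apply is_derive_Reals, Hf. lra. }
  exists p, q. repeat split; try lra. unfold convexity_gap.
  replace ((v - w) * f u + (w - u) * f v - (v - u) * f w)
    with ((w - u) * (f v - f w) - (v - w) * (f w - f u)) by ring.
  rewrite Ep, Eq. ring.
Qed.

Lemma strictly_convex_of_second_derivative (f df ddf : R -> R) :
  (forall z, 0 < z -> is_derive f z (df z)) ->
  (forall z, 0 < z -> is_derive df z (ddf z)) ->
  (forall z, 0 < z -> 0 < ddf z) ->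
  strictly_convex_pos f.
Proof.
  intros Hf Hdf Hpos u w v Hu Huw Hwv.
  destruct (convexity_gap_mean_value f df u w v Hf Hu Huw Hwv) as (p & q & Hp & Hq & ->).
  destruct (MVT_cor2 df ddf p q) as (r & -> & Hr); [lra| |].
  { intros z Hz. apply is_derive_Reals, Hdf. lra. }
  apply Rmult_lt_0_compat; apply Rmult_lt_0_compat; try lra.
  apply Hpos. lra.
Qed.

Lemma strictly_convex_weaken f : strictly_convex_pos f -> convex_pos f.
Proof. intros H u w v Hu Huw Hwv. left. now apply H. Qed.

Lemma strictly_convex_xlnx : strictly_convex_pos (fun z => z * ln z).
Proof.
  apply (strictly_convex_of_second_derivative _ (fun z => ln z + 1) (fun z => / z)).
  - intros z Hz. auto_derive; [exact Hz | field; lra].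
  - intros z Hz. auto_derive; [exact Hz | field; lra].
  - intros z Hz. now apply Rinv_0_lt_compat.
Qed.

Lemma strictly_convex_neg_ln : strictly_convex_pos (fun z => - ln z).
Proof.
  apply (strictly_convex_of_second_derivative _ (fun z => - / z)
           (fun z => / (z * z))).
  - intros z Hz. auto_derive; [exact Hz | field; lra].
  - intros z Hz. auto_derive; [lra | field; lra].
  - intros z Hz. apply Rinv_0_lt_compat. nra.
Qed.

(** The gap of f at (u, w, v) is the sum of the gaps of f(z) - f(z + 1) at the
    first n translates plus the gap of f at the n-th one. All summands are
    positive and the first does not depend on n, so it is enough that the
    remainder is bounded below by something tending to 0. *)
Lemma strictly_convex_of_unit_differences (f : R -> R) :
  strictly_convex_pos (fun z => f z - f (z + 1)) ->
  (forall u w v, 0 < u -> u < w -> w < v -> exists C, forall s, 0 <= s ->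
     - (C / (u + s)) <= convexity_gap f (u + s + 1) (w + s + 1) (v + s + 1)) ->
  strictly_convex_pos f.
Proof.
  intros Hd Hlim u w v Hu Huw Hwv.
  set (d := fun z => f z - f (z + 1)).
  assert (Hstep : forall u w v,
    convexity_gap f u w v = convexity_gap d u w v + convexity_gap f (u + 1) (w + 1) (v + 1)).
  { intros. unfold convexity_gap, d. ring. }
  assert (Htel : forall n : nat,
    convexity_gap d u w v + convexity_gap f (u + INR n + 1) (w + INR n + 1) (v + INR n + 1)
      <= convexity_gap f u w v).
  { induction n as [|n IH].
    - simpl. rewrite !Rplus_0_r, (Hstep u w v). lra.
    - rewrite S_INR, <- !Rplus_assoc. rewrite Hstep in IH.
      assert (Hn := pos_INR n).
      assert (H := Hd (u + INR n + 1) (w + INR n + 1) (v + INR n + 1)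
                     ltac:(lra) ltac:(lra) ltac:(lra)).
      fold d in H. lra. }
  assert (Hpos := Hd u w v Hu Huw Hwv). fold d in Hpos.
  destruct (Hlim u w v Hu Huw Hwv) as [C HC].
  destruct (INR_unbounded (C / convexity_gap d u w v)) as [n Hn].
  assert (Hn0 := pos_INR n). specialize (HC (INR n) Hn0).
  apply Rlt_gt, Rlt_div_l in Hn; [|exact Hpos].
  assert (C / (u + INR n) < convexity_gap d u w v) by (apply Rlt_div_l; nra).
  specialize (Htel n). lra.
Qed.

Lemma ln_diff_le p q : 0 < p -> 0 < q -> ln q - ln p <= (q - p) / p.
Proof.
  intros Hp Hq. assert (H := ln_le_sub_1 (q / p) ltac:(now apply Rdiv_lt_0_compat)).
  rewrite ln_div in H by assumption.
  replace ((q - p) / p) with (q / p - 1) by (field; lra). exact H.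
Qed.

(** By convexity the slope over [u, w] is at least the one over [u - 1, u] and the
    slope over [w, v] is at most the one over [v, v + 1]; the functional equation
    evaluates these two as ln (u - 1) and ln v. *)
Lemma convexity_gap_lnGamma_le u w v : 1 < u -> u < w -> w < v ->
  convexity_gap lnGamma u w v <= (w - u) * (v - w) * (ln v - ln (u - 1)).
Proof.
  intros Hu Huw Hwv.
  assert (Hl := lnGamma_convex (u - 1) u w ltac:(lra) ltac:(lra) Huw).
  assert (Hr := lnGamma_convex w v (v + 1) ltac:(lra) Hwv ltac:(lra)).
  unfold convexity_gap in *.
  assert (El := lnGamma_succ (u - 1) ltac:(lra)).
  replace (u - 1 + 1) with u in El by ring.
  assert (Er := lnGamma_succ v ltac:(lra)). rewrite Er in Hr.
  assert (Hl' : (w - u) * ln (u - 1) <= ln (Gamma w) - ln (Gamma u)).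
  { rewrite El in *. lra. }
  assert (Hr' : ln (Gamma v) - ln (Gamma w) <= (v - w) * ln v) by lra.
  apply (Rmult_le_compat_l (v - w)) in Hl'; [|lra].
  apply (Rmult_le_compat_l (w - u)) in Hr'; [|lra].
  lra.
Qed.

(** * The two strictly convex comparisons for ln Gamma *)

(** The unit difference is (z + 1/2) ln (1 + 1/z), of second derivative
    (1/z - 1/(z+1))^2 / 2. Far out, ln Gamma has a nonnegative gap and the gap of
    (z - 1/2) ln z is controlled by the variation of its derivative. *)
Lemma lnGamma_sub_strictly_convex :
  strictly_convex_pos (fun z => ln (Gamma z) - (z - / 2) * ln z).
Proof.
  apply strictly_convex_of_unit_differences.
  - set (h := fun z => (z + / 2) * (ln (z + 1) - ln z)).
    assert (Hh : strictly_convex_pos h).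
    { apply (strictly_convex_of_second_derivative h
        (fun z => ln (z + 1) - ln z + (z + / 2) * (/ (z + 1) - / z))
        (fun z => / 2 * (/ z - / (z + 1)) ^ 2)).
      - intros z Hz. unfold h. auto_derive; [lra | field; lra].
      - intros z Hz. auto_derive; [lra | field; lra].
      - intros z Hz. apply Rmult_lt_0_compat; [lra|]. apply pow_lt.
        assert (/ (z + 1) < / z) by (apply Rinv_lt_contravar; nra). lra. }
    intros u w v Hu Huw Hwv.
    assert (H := Hh u w v Hu Huw Hwv). unfold convexity_gap, h in *.
    rewrite !lnGamma_succ by lra. lra.
  - intros u w v Hu Huw Hwv.
    exists ((w - u) * (v - w) * (v - u + 1)). intros s Hs.
    set (g := fun z => (z - / 2) * ln z).
    assert (HL := lnGamma_convex (u + s + 1) (w + s + 1) (v + s + 1)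
                    ltac:(lra) ltac:(lra) ltac:(lra)).
    destruct (convexity_gap_mean_value g (fun z => ln z + 1 - / 2 * / z)
                (u + s + 1) (w + s + 1) (v + s + 1))
      as (p & q & Hp & Hq & Eg); try lra.
    { intros z Hz. unfold g. auto_derive; [exact Hz | field; lra]. }
    assert (Hln := ln_diff_le p q ltac:(lra) ltac:(lra)).
    assert (Hdg : ln q + 1 - / 2 * / q - (ln p + 1 - / 2 * / p)
                  <= (v - u + 1) / (u + s)).
    { assert (0 < / q) by (apply Rinv_0_lt_compat; lra).
      assert (Hip : / p <= / (u + s)) by (apply Rinv_le_contravar; lra).
      assert (0 < / p) by (apply Rinv_0_lt_compat; lra).
      unfold Rdiv in *.
      assert ((q - p) * / p <= (v - u) * / (u + s))
        by (apply Rmult_le_compat; lra).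
      lra. }
    apply (Rmult_le_compat_l ((w - u) * (v - w))) in Hdg; [|nra].
    unfold convexity_gap, g, Rdiv in *. lra.
Qed.

(** The unit difference is - z ln (1 + 1/z), of second derivative
    1 / (z (z+1)^2). Far out, (z - 1) ln z has a positive gap and the gap of
    ln Gamma is controlled by [convexity_gap_lnGamma_le]. *)
Lemma sub_lnGamma_strictly_convex :
  strictly_convex_pos (fun z => (z - 1) * ln z - ln (Gamma z)).
Proof.
  apply strictly_convex_of_unit_differences.
  - set (h := fun z => z * (ln z - ln (z + 1))).
    assert (Hh : strictly_convex_pos h).
    { apply (strictly_convex_of_second_derivative h
        (fun z => ln z - ln (z + 1) + / (z + 1))
        (fun z => / (z * (z + 1) ^ 2))).
      - intros z Hz. unfold h. auto_derive; [lra | field; lra].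
      - intros z Hz. auto_derive; [lra | field; lra].
      - intros z Hz. apply Rinv_0_lt_compat, Rmult_lt_0_compat; [lra|].
        apply pow_lt; lra. }
    intros u w v Hu Huw Hwv.
    assert (H := Hh u w v Hu Huw Hwv). unfold convexity_gap, h in *.
    rewrite !lnGamma_succ by lra. lra.
  - intros u w v Hu Huw Hwv.
    exists ((w - u) * (v - w) * (v - u + 1)). intros s Hs.
    assert (Hx := strictly_convex_xlnx (u + s + 1) (w + s + 1) (v + s + 1)
                    ltac:(lra) ltac:(lra) ltac:(lra)).
    assert (Hn := strictly_convex_neg_ln (u + s + 1) (w + s + 1) (v + s + 1)
                    ltac:(lra) ltac:(lra) ltac:(lra)).
    assert (HL := convexity_gap_lnGamma_le (u + s + 1) (w + s + 1) (v + s + 1)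
                    ltac:(lra) ltac:(lra) ltac:(lra)).
    assert (Hln := ln_diff_le (u + s) (v + s + 1) ltac:(lra) ltac:(lra)).
    replace (u + s + 1 - 1) with (u + s) in HL by ring.
    apply (Rmult_le_compat_l ((w - u) * (v - w))) in Hln; [|nra].
    unfold convexity_gap, Rdiv in *. lra.
Qed.

(** * Slopes of convex functions from a fixed point *)
Definition slope (f : R -> R) (c z : R) := (f z - f c) / (z - c).

(** The position of c relative to z and z' decides which triple occurs, but not f;
    hence the convex and the strictly convex case both follow. *)
Lemma slope_diff c z z' : 0 < c -> 0 < z -> z < z' -> z <> c -> z' <> c ->
  exists k u w v, 0 < k /\ (0 < u /\ u < w /\ w < v) /\
    forall f, slope f c z' - slope f c z = k * convexity_gap f u w v.
Proof.
  intros Hc Hz Hzz' Hzc Hzc'.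
  destruct (Rlt_or_le c z) as [H1 | H1]; [|destruct (Rlt_or_le c z') as [H2 | H2]].
  - exists (/ ((z - c) * (z' - c))), c, z, z'.
    split; [apply Rinv_0_lt_compat; nra|]. split; [lra|].
    intros f. unfold slope, convexity_gap. field. lra.
  - exists (/ ((c - z) * (z' - c))), z, c, z'.
    split; [apply Rinv_0_lt_compat; nra|]. split; [lra|].
    intros f. unfold slope, convexity_gap. field. lra.
  - exists (/ ((c - z) * (c - z'))), z, z', c.
    split; [apply Rinv_0_lt_compat; nra|]. split; [lra|].
    intros f. unfold slope, convexity_gap. field. lra.
Qed.

Lemma slope_le f c z z' : convex_pos f ->
  0 < c -> 0 < z -> z < z' -> z <> c -> z' <> c -> slope f c z <= slope f c z'.
Proof.
  intros Hf Hc Hz Hzz' Hzc Hzc'.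
  destruct (slope_diff c z z') as (k & u & w & v & Hk & (Hu & Huw & Hwv) & E);
    try assumption.
  specialize (E f). assert (H := Hf u w v Hu Huw Hwv). nra.
Qed.

Lemma slope_lt f c z z' : strictly_convex_pos f ->
  0 < c -> 0 < z -> z < z' -> z <> c -> z' <> c -> slope f c z < slope f c z'.
Proof.
  intros Hf Hc Hz Hzz' Hzc Hzc'.
  destruct (slope_diff c z z') as (k & u & w & v & Hk & (Hu & Huw & Hwv) & E);
    try assumption.
  specialize (E f). assert (H := Hf u w v Hu Huw Hwv). nra.
Qed.

Lemma is_derive_slope f c d : 0 < c ->
  is_derive f c d <->
  (forall e, 0 < e -> exists r, 0 < r <= c /\
     forall z, z <> c -> c - r < z < c + r -> Rabs (slope f c z - d) < e).
Proof.
  intros Hc. split.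
  - intros H e He. apply is_derive_Reals in H. destruct (H e He) as [r Hr].
    assert (Hr0 := cond_pos r).
    exists (Rmin r c). split.
    { split; [now apply Rmin_glb_lt | apply Rmin_r]. }
    intros z Hzc Hz. assert (Hm := Rmin_l r c).
    specialize (Hr (z - c) ltac:(lra)). unfold slope.
    replace (c + (z - c)) with z in Hr by ring.
    apply Hr. apply Rabs_def1; lra.
  - intros H. apply is_derive_Reals. intros e He.
    destruct (H e He) as (r & Hr & Hs). exists (mkposreal r (proj1 Hr)).
    intros h Hh Hhr. simpl in Hhr. apply Rabs_def2 in Hhr.
    specialize (Hs (c + h) ltac:(lra) ltac:(lra)). unfold slope in Hs.
    replace (c + h - c) with h in Hs by ring. exact Hs.
Qed.

(** Take the supremum of the slopes to the left of c. *)
Lemma supporting_slope f c : convex_pos f -> 0 < c ->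
  exists p, (forall z, 0 < z < c -> slope f c z <= p) /\
            (forall z, c < z -> p <= slope f c z).
Proof.
  intros Hf Hc.
  destruct (completeness (fun s => exists z, 0 < z < c /\ s = slope f c z))
    as [p [Hub Hlub]].
  - exists (slope f c (c + 1)). intros s (z & Hz & ->). apply slope_le; auto; lra.
  - exists (slope f c (c / 2)), (c / 2). split; [lra | reflexivity].
  - exists p. split.
    + intros z Hz. apply Hub. now exists z.
    + intros z Hz. apply Hlub. intros s (z' & Hz' & ->). apply slope_le; auto; lra.
Qed.

(** Let p and q be supporting slopes of f and g at c. The slopes of f + g lie below
    p + q on the left of c and above it on the right, so the derivative of f + g
    is p + q. On each side of c, slope f - p and slope g - q have the same sign, so
    each is bounded in absolute value by their sum, which tends to 0. *)
Lemma ex_derive_of_convex_sum f g c : convex_pos f -> convex_pos g -> 0 < c ->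
  ex_derive (fun z => f z + g z) c -> ex_derive f c.
Proof.
  intros Hf Hg Hc [d Hd].
  destruct (supporting_slope f c Hf Hc) as (p & Hpl & Hpr).
  destruct (supporting_slope g c Hg Hc) as (q & Hql & Hqr).
  rewrite is_derive_slope in Hd by exact Hc.
  assert (Hsum : forall z, z <> c ->
    slope (fun z => f z + g z) c z = slope f c z + slope g c z).
  { intros z Hz. unfold slope. field. lra. }
  assert (Hpq : p + q = d).
  { apply Rle_antisym; apply Rnot_lt_le; intros Hlt.
    - destruct (Hd (p + q - d) ltac:(lra)) as (r & Hr & Hz).
      specialize (Hz (c + r / 2) ltac:(lra) ltac:(lra)).
      rewrite Hsum in Hz by lra. apply Rabs_def2 in Hz.
      specialize (Hpr (c + r / 2) ltac:(lra)).
      specialize (Hqr (c + r / 2) ltac:(lra)). lra.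
    - destruct (Hd (d - (p + q)) ltac:(lra)) as (r & Hr & Hz).
      specialize (Hz (c - r / 2) ltac:(lra) ltac:(lra)).
      rewrite Hsum in Hz by lra. apply Rabs_def2 in Hz.
      specialize (Hpl (c - r / 2) ltac:(lra)).
      specialize (Hql (c - r / 2) ltac:(lra)). lra. }
  exists p. apply is_derive_slope; [exact Hc|]. intros e He.
  destruct (Hd e He) as (r & Hr & Hz). exists r. split; [exact Hr|].
  intros z Hzc Hzr. specialize (Hz z Hzc Hzr). rewrite Hsum in Hz by exact Hzc.
  apply Rabs_def2 in Hz.
  destruct (Rdichotomy z c Hzc) as [Hlt | Hgt].
  - specialize (Hpl z ltac:(lra)). specialize (Hql z ltac:(lra)).
    apply Rabs_def1; lra.
  - specialize (Hpr z ltac:(lra)). specialize (Hqr z ltac:(lra)).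
    apply Rabs_def1; lra.
Qed.

Definition ext_slope (f : R -> R) (c z : R) :=
  if Req_EM_T z c then Derive f c else slope f c z.

(** The only new case is that one of the points is c. The derivative is a limit of
    slopes, hence it lies weakly on the right side of the slope to a point m
    strictly between; strictness comes from moving from m to the other point. *)
Lemma ext_slope_lt f c z z' : strictly_convex_pos f -> ex_derive f c ->
  0 < c -> 0 < z -> z < z' -> ext_slope f c z < ext_slope f c z'.
Proof.
  intros Hf Hex Hc Hz Hzz'.
  assert (Hd := Derive_correct f c Hex). rewrite is_derive_slope in Hd by exact Hc.
  unfold ext_slope.
  destruct (Req_EM_T z c) as [-> | Hzc]; destruct (Req_EM_T z' c) as [Ec | Hzc'].
  - lra.
  - set (m := (c + z') / 2).
    apply Rle_lt_trans with (slope f c m); [|apply slope_lt; auto; unfold m; lra].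
    apply Rnot_lt_le. intros Hlt.
    destruct (Hd (Derive f c - slope f c m) ltac:(lra)) as (r & Hr & H).
    set (h := Rmin r (m - c) / 2).
    assert (Hh : 0 < h /\ h < r /\ h < m - c).
    { assert (0 < Rmin r (m - c)) by (apply Rmin_glb_lt; unfold m; lra).
      assert (H1 := Rmin_l r (m - c)). assert (H2 := Rmin_r r (m - c)).
      unfold h. lra. }
    specialize (H (c + h) ltac:(lra) ltac:(lra)). apply Rabs_def2 in H.
    assert (slope f c (c + h) < slope f c m) by (apply slope_lt; auto; lra).
    lra.
  - subst z'. set (m := (z + c) / 2).
    apply Rlt_le_trans with (slope f c m); [apply slope_lt; auto; unfold m; lra|].
    apply Rnot_lt_le. intros Hlt.
    destruct (Hd (slope f c m - Derive f c) ltac:(lra)) as (r & Hr & H).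
    set (h := Rmin r (c - m) / 2).
    assert (Hh : 0 < h /\ h < r /\ h < c - m).
    { assert (0 < Rmin r (c - m)) by (apply Rmin_glb_lt; unfold m; lra).
      assert (H1 := Rmin_l r (c - m)). assert (H2 := Rmin_r r (c - m)).
      unfold h. lra. }
    specialize (H (c - h) ltac:(lra) ltac:(lra)). apply Rabs_def2 in H.
    assert (slope f c m < slope f c (c - h)) by (apply slope_lt; auto; unfold m in *; lra).
    lra.
  - apply slope_lt; auto.
Qed.

(** * Slopes of ln Gamma and the double inequality *)
Lemma ex_derive_lnGamma c : 0 < c -> ex_derive lnGamma c.
Proof.
  intros Hc.
  assert (H := ex_derive_of_convex_sum _ _ c
    (strictly_convex_weaken _ lnGamma_sub_strictly_convex)
    (strictly_convex_weaken _ sub_lnGamma_strictly_convex) Hc).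
  simpl in H.
  assert (H' : ex_derive (fun z => (ln (Gamma z) - (z - / 2) * ln z)
                                   + (z - / 2) * ln z) c).
  { apply (ex_derive_plus (V := R_NormedModule)).
    - apply H. apply (ex_derive_ext (fun z => - / 2 * ln z)).
      + intros z. simpl. field.
      + auto_derive. exact Hc.
    - auto_derive. exact Hc. }
  revert H'. apply ex_derive_ext. intros z. simpl. ring.
Qed.

Lemma Derive_lnGamma c : 0 < c -> Derive lnGamma c = digamma c.
Proof.
  intros Hc.
  assert (HG : ex_derive Gamma c).
  { apply (ex_derive_ext_loc (fun z => exp (ln (Gamma z)))).
    - exists (mkposreal c Hc). intros z Hz.
      unfold ball in Hz; simpl in Hz;
        unfold AbsRing_ball, abs, minus, plus, opp in Hz; simpl in Hz.
      apply Rabs_def2 in Hz. apply exp_ln, Gamma_pos. lra.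
    - destruct (ex_derive_lnGamma c Hc) as [d Hd].
      exists (d * exp (ln (Gamma c))).
      apply (is_derive_comp exp lnGamma); [apply is_derive_exp | exact Hd]. }
  unfold digamma. apply is_derive_unique.
  apply (is_derive_comp ln Gamma c (/ Gamma c) (Derive Gamma c)).
  - apply is_derive_ln, Gamma_pos, Hc.
  - apply Derive_correct, HG.
Qed.

Lemma gamma_ratio_root_exp y x : 0 < y + 1 -> 0 < x + y + 1 ->
  gamma_ratio_root y x = exp (ext_slope lnGamma (y + 1) (x + y + 1)).
Proof.
  intros Hy Hx. unfold gamma_ratio_root, ext_slope.
  destruct (Req_EM_T x 0) as [H | H];
    destruct (Req_EM_T (x + y + 1) (y + 1)) as [H' | H']; try (exfalso; lra).
  - now rewrite Derive_lnGamma.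
  - unfold Rpower, slope. rewrite ln_div by (now apply Gamma_pos).
    f_equal. field. lra.
Qed.

(** The slope of (z - c) ln z from c is ln z, and this remains true at z = c,
    where its derivative is ln c. *)
Lemma ext_slope_combination k e c z : 0 < c -> 0 < z ->
  let K := fun z => k * ((z - c) * ln z) + e * ln (Gamma z) in
  ex_derive K c /\ ext_slope K c z = k * ln z + e * ext_slope lnGamma c z.
Proof.
  intros Hc Hz K.
  destruct (ex_derive_lnGamma c Hc) as [d Hd].
  assert (HK : is_derive K c (k * ln c + e * d)).
  { apply (is_derive_plus (V := R_NormedModule)).
    - auto_derive; [exact Hc | field; lra].
    - now apply (is_derive_scal lnGamma). }
  split; [now exists (k * ln c + e * d)|].
  unfold ext_slope. destruct (Req_EM_T z c) as [-> | Hzc].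
  - rewrite (is_derive_unique _ _ _ HK). do 2 f_equal.
    symmetry. exact (is_derive_unique _ _ _ Hd).
  - unfold slope, K. field. lra.
Qed.

(** L(z) - b (z - c) ln z equals
    (L(z) - (z - 1/2) ln z) + (1 - b) z ln z + (1/2 - b c) (- ln z). *)
Lemma ext_slope_lnGamma_lower b c z z' : 0 < c -> b <= 1 -> b * c <= / 2 ->
  0 < z -> z < z' ->
  b * (ln z' - ln z) < ext_slope lnGamma c z' - ext_slope lnGamma c z.
Proof.
  intros Hc Hb Hbc Hz Hzz'.
  destruct (ext_slope_combination (- b) 1 c z Hc Hz) as [HK E].
  destruct (ext_slope_combination (- b) 1 c z' Hc ltac:(lra)) as [_ E'].
  assert (H : strictly_convex_pos
    (fun z => - b * ((z - c) * ln z) + 1 * ln (Gamma z))).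
  { intros u w v Hu Huw Hwv.
    assert (HM := lnGamma_sub_strictly_convex u w v Hu Huw Hwv).
    assert (HX := Rmult_le_pos (1 - b) _ ltac:(lra)
                    (Rlt_le _ _ (strictly_convex_xlnx u w v Hu Huw Hwv))).
    assert (HN := Rmult_le_pos (/ 2 - b * c) _ ltac:(lra)
                    (Rlt_le _ _ (strictly_convex_neg_ln u w v Hu Huw Hwv))).
    unfold convexity_gap in *. lra. }
  assert (Hlt := ext_slope_lt _ c z z' H HK Hc Hz Hzz').
  rewrite E, E' in Hlt. lra.
Qed.

(** a (z - c) ln z - L(z) equals
    ((z - 1) ln z - L(z)) + (a - 1) z ln z + (a c - 1) (- ln z). *)
Lemma ext_slope_lnGamma_upper a c z z' : 0 < c -> 1 <= a -> 1 <= a * c ->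
  0 < z -> z < z' ->
  ext_slope lnGamma c z' - ext_slope lnGamma c z < a * (ln z' - ln z).
Proof.
  intros Hc Ha Hac Hz Hzz'.
  destruct (ext_slope_combination a (-1) c z Hc Hz) as [HK E].
  destruct (ext_slope_combination a (-1) c z' Hc ltac:(lra)) as [_ E'].
  assert (H : strictly_convex_pos
    (fun z => a * ((z - c) * ln z) + -1 * ln (Gamma z))).
  { intros u w v Hu Huw Hwv.
    assert (HM := sub_lnGamma_strictly_convex u w v Hu Huw Hwv).
    assert (HX := Rmult_le_pos (a - 1) _ ltac:(lra)
                    (Rlt_le _ _ (strictly_convex_xlnx u w v Hu Huw Hwv))).
    assert (HN := Rmult_le_pos (a * c - 1) _ ltac:(lra)
                    (Rlt_le _ _ (strictly_convex_neg_ln u w v Hu Huw Hwv))).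
    unfold convexity_gap in *. lra. }
  assert (Hlt := ext_slope_lt _ c z z' H HK Hc Hz Hzz').
  rewrite E, E' in Hlt. lra.
Qed.

Theorem theorem2 (t x y a b : R)
  (ht : t > 0) (hy : y + 1 > 0) (hxy : x + y + 1 > 0)
  (ha : a >= Rmax 1 (1 / (y + 1)))
  (hb : b <= Rmin 1 (1 / (2 * (y + 1)))) :
  Rpower ((x + y + 1) / (x + y + t + 1)) a
    < gamma_ratio_root y x / gamma_ratio_root y (x + t)
  /\
  gamma_ratio_root y x / gamma_ratio_root y (x + t)
    < Rpower ((x + y + 1) / (x + y + t + 1)) b.
Proof.
  rewrite !gamma_ratio_root_exp by lra.
  replace (x + t + y + 1) with (x + y + t + 1) by ring.
  unfold Rdiv at 2 3. rewrite <- exp_Ropp, <- exp_plus.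
  unfold Rpower. rewrite ln_div by lra.
  assert (Hzz : x + y + 1 < x + y + t + 1) by lra.
  assert (Ha1 := Rmax_l 1 (1 / (y + 1))). assert (Ha2 := Rmax_r 1 (1 / (y + 1))).
  assert (Hb1 := Rmin_l 1 (1 / (2 * (y + 1)))).
  assert (Hb2 := Rmin_r 1 (1 / (2 * (y + 1)))).
  assert (Hac : 1 <= a * (y + 1)) by (apply Rle_div_l; lra).
  assert (Hbc : b * (2 * (y + 1)) <= 1) by (apply Rle_div_r; lra).
  assert (Hlo := ext_slope_lnGamma_lower b (y + 1) _ _ ltac:(lra) ltac:(lra)
                   ltac:(lra) hxy Hzz).
  assert (Hup := ext_slope_lnGamma_upper a (y + 1) _ _ ltac:(lra) ltac:(lra)
                   ltac:(lra) hxy Hzz).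
  split; apply exp_increasing; lra.
Qed.
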